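(* In the interview query model, every deterministic or randomized online algorithm for finding the $B$-optimal stable matching in a stable matching instance with one-sided uncertainty has competitive ratio $\Omega(n)$.
   Context: Two disjoint sets $A$, $B$ of agents with $|A|=|B|=n$. Each $a\in A$ has a strict total order $\prec_a$ on $B$ and each $b\in B$ has a strict total order $\prec_b$ on $A$ ($x\prec_y z$: $y$ prefers $x$ to $z$). A matching is a bijection between $A$ and $B$; it is stable if there is no pair $(a,b)$, $b\neq M(a)$, with $a$ preferring $b$ to $M(a)$ and $b$ preferring $a$ to $M(b)$. A stable matching is $B$-optimal if every agent of $B$ weakly prefers its partner in it to its partner in any other stable matching. One-sided uncertainty: the orders $\prec_a$ ($a\in A$) are known, the orders $\prec_b$ ($b\in B$) are unknown and learned only via queries. An interview query $\mathit{intq}(b,a)$ for $b\in B$, $a\in A$ reveals the restriction of $\prec_b$ to $\{a\}\cup P_b$, where $P_b$ is the set of all $a'\in A$ for which $\mathit{intq}(b,a')$ was executed before. An online algorithm queries adaptively until the known information proves its output correct. Its competitive ratio is the supremum over instances of the ratio between its number of queries (expected number for randomized algorithms) and the minimum size of a query set whose answers on that instance suffice to prove the correct output. *)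

(* Defs.v *)
From HB Require Import structures.
From mathcomp Require Import all_boot all_order all_algebra.
From mathcomp Require Import all_classical all_reals all_analysis.
Set Implicit Arguments.
Unset Strict Implicit.
Unset Printing Implicit Defensive.

Import Order.TTheory GRing.Theory Num.Theory.

Record strict_total_order (X : finType) := StrictTotalOrder {
  before :> rel X;
  before_irr : irreflexive before;
  before_trans : transitive before;
  before_total : forall x y, x != y -> before x y || before y x
}.

Section StableMatching.
Variables A B : finType.

(* [prefA I a x z] reads: [a] prefers [x] to [z]; similarly for [prefB]. *)
Record instance := Instance {
  prefA : A -> strict_total_order B;
  prefB : B -> strict_total_order A
}.

Record matching := Matching {
  ofA : A -> B;
  ofB : B -> A;
  ofAK : cancel ofA ofB;
  ofBK : cancel ofB ofA
}.

Definition blocking (I : instance) (M : matching) (a : A) (b : B) : bool :=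
  [&& b != ofA M a, prefA I a b (ofA M a) & prefB I b a (ofB M b)].

Definition stable (I : instance) (M : matching) : Prop :=
  forall a b, ~~ blocking I M a b.

Definition B_optimal (I : instance) (M : matching) : Prop :=
  stable I M /\
  forall M', stable I M' ->
    forall b, ofB M b = ofB M' b \/ prefB I b (ofB M b) (ofB M' b).

(* [queried Q b] is the set P_b when exactly the queries in [Q] were made. *)
Definition queried (Q : {set B * A}) (b : B) : {set A} :=
  finset (fun a => (b, a) \in Q).

(* The restriction of the order of [b] to [P], given by its graph. *)
Definition restriction (I : instance) (b : B) (P : {set A}) : {set A * A} :=
  finset (fun p => [&& p.1 \in P, p.2 \in P & prefB I b p.1 p.2]).

(* The answer to the query [intq(b, a)], executed after those in [Q]. *)
Definition intq (I : instance) (Q : {set B * A}) (b : B) (a : A) :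
  {set A * A} := restriction I b (a |: queried Q b)%SET.

(* The answers to a set of queries jointly reveal, whatever the order in which
   the queries are executed, the restriction of each [prefB I b] to
   [queried Q b]: the last query for [b] reveals all of it. *)
Definition consistent (Q : {set B * A}) (I I' : instance) : Prop :=
  (forall a x y, prefA I a x y = prefA I' a x y) /\
  (forall b, restriction I b (queried Q b) = restriction I' b (queried Q b)).

Definition proves (I : instance) (Q : {set B * A}) (M : matching) : Prop :=
  forall I', consistent Q I I' -> B_optimal I' M.

Definition sufficient (I : instance) (Q : {set B * A}) : Prop :=
  exists M, proves I Q M.

(* When #|A| = #|B|, the full query set is sufficient, because it reveals all
   preferences and a B-optimal stable matching exists: this is a true minimum. *)
Definition opt (I : instance) : nat :=
  #|[arg min_(Q < [set: B * A]%SET | `[< sufficient I Q >]) #|Q|]%N|.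

(* Query strategies: each step either outputs a matching or executes one query
   and continues according to its answer. *)
Inductive strategy :=
| Output of matching
| Query of B & A & ({set A * A} -> strategy).

(* The queries executed (in order, with repetitions) from the state where those
   in [Q] have been made, and the final output. *)
Fixpoint run (I : instance) (Q : {set B * A}) (s : strategy) :
    seq (B * A) * matching :=
  match s with
  | Output M => ([::], M)
  | Query b a k =>
      let r := run I ((b, a) |: Q)%SET (k (intq I Q b a)) in
      ((b, a) :: r.1, r.2)
  end.

(* One-sided uncertainty: the preferences of the agents in [A] are an input. *)
Definition algorithm := (A -> strict_total_order B) -> strategy.

Definition execute (alg : algorithm) (I : instance) : seq (B * A) * matching :=
  run I finset.set0 (alg (prefA I)).

Definition num_queries (alg : algorithm) (I : instance) : nat :=
  size (execute alg I).1.

Definition solves (alg : algorithm) : Prop :=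
  forall I, proves I (finset (fun q => q \in (execute alg I).1))
                     (execute alg I).2.

(* [cost I] is the (expected) number of queries on [I]. In [\bar R] we have
   [x / 0 = +oo] for [0 < x] and [0 / 0 = 0], so that the ratio is at most [r]
   on [I] exactly when [cost I <= r * opt I], for real [r >= 0]. *)
Definition competitive_ratio (R : realType) (cost : instance -> \bar R) :
    \bar R :=
  ereal_sup (range (fun I => cost I / (opt I)%:R%:E)%E).

Definition det_ratio (R : realType) (alg : algorithm) : \bar R :=
  competitive_ratio (fun I => (((num_queries alg I)%:R%R)%:E)%E).

(* A randomized algorithm is a random deterministic one, with random seed drawn
   from an arbitrary probability space, that is correct almost surely. *)
Definition randomized_solves d (T : measurableType d) (R : realType)
    (P : probability T R) (alg : T -> algorithm) : Prop :=
  (forall I, measurable_fun (classical_sets.setT : set T)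
               (fun w => (num_queries (alg w) I)%:R%R : R)) /\
  {ae P, forall w, solves (alg w)}.

Definition rand_ratio d (T : measurableType d) (R : realType)
    (P : probability T R) (alg : T -> algorithm) : \bar R :=
  competitive_ratio
    (fun I => expectation P (fun w => (num_queries (alg w) I)%:R%R)).

End StableMatching.

(* Main.v *)
Require Import Defs.
From mathcomp Require Import all_boot all_order all_algebra.
From mathcomp Require Import all_classical all_reals all_analysis.
From mathcomp Require Import perm measurable_realfun zify.
Set Implicit Arguments.
Unset Strict Implicit.
Unset Printing Implicit Defensive.

Import Order.TTheory GRing.Theory Num.Theory.

(* Fix a bijection M and agents star, x_1 .. x_m, t_1 .. t_m of A, with n about
   3m.  Everybody in A but star has its M-partner as top choice, while star has it
   as last choice.  The lists continue with the partners of the t's for an x, and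
   with the partner of star for a t.  In B, nobody prefers star to its M-partner,
   the partner of star prefers all t's to star, and for a hidden f the partner of
   t_(f i) prefers x_i to t_(f i).  Then M is the only stable matching, and O(n)
   queries prove it: star is stuck, hence so are the t's, hence so are the x's.
   If an algorithm has not found the edge to x_i and not that to x_i' either,
   then it has to exclude that x_i and x_i' exchange partners, by a query specific
   to this pair.  But finding a hidden edge takes about m/2 queries on average over
   a uniformly random f.  Hence a correct algorithm makes at least m^2/8 queries on
   average over f, and a randomized algorithm needs this many in expectation for
   some f. *)

(** * Strict orders built from levels *)

Lemma before_asym (X : finType) (o : strict_total_order X) y z :
  o y z -> ~~ o z y.
Proof.
by move=> oyz; apply/negP => ozy; have := before_trans oyz ozy; rewrite before_irr.
Qed.

Section RankOrder.
Variables (X : finType) (lev : X -> nat).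

(* Ties between elements of the same level are broken by enumeration order. *)
Definition rank (x : X) : nat := lev x * #|X| + enum_rank x.

Lemma rank_lt x y : lev x < lev y -> rank x < rank y.
Proof.
move=> h; apply: (@leq_trans ((lev x).+1 * #|X|)).
  by rewrite mulSnr /rank ltn_add2l ltn_ord.
by apply: leq_trans (leq_addr _ _); rewrite leq_mul2r h orbT.
Qed.

Lemma rank_lt_lev x y : rank x < rank y -> lev x <= lev y.
Proof.
by move=> h; rewrite leqNgt; apply/negP => /rank_lt /(ltn_trans h); rewrite ltnn.
Qed.

Lemma rank_inj : injective rank.
Proof.
move=> x y e; have exy : lev x = lev y.
  by case: (ltngtP (lev x) (lev y)) => // /rank_lt; rewrite e ltnn.
by move: e; rewrite /rank exy => /addnI /val_inj /enum_rank_inj.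
Qed.

Definition rank_order : strict_total_order X.
Proof.
apply: (@StrictTotalOrder X (fun x y => rank x < rank y)).
- by move=> x; rewrite ltnn.
- by move=> y x z; exact: ltn_trans.
- by move=> x y nxy; rewrite -neq_ltn; apply: contra nxy => /eqP /rank_inj ->.
Defined.

End RankOrder.

(** * Consistency of answers, and runs on two instances *)

Section Runs.
Variables A B : finType.
Implicit Types (I : instance A B) (Q : {set B * A}).

Lemma consistent_refl Q I : consistent Q I I.
Proof. by split. Qed.

Lemma consistentS Q Q' I I' :
  Q \subset Q' -> consistent Q' I I' -> consistent Q I I'.
Proof.
move=> sQ [hA hB]; split=> // b; apply/setP => -[y z].
have /setP/(_ (y, z)) := hB b; rewrite !inE /=.
case yQ: (_ \in Q) => //; case zQ: (_ \in Q) => //.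
by rewrite (fintype.subsetP sQ _ yQ) (fintype.subsetP sQ _ zQ).
Qed.

Lemma consistent_prefB Q I I' b y z : consistent Q I I' ->
  (b, y) \in Q -> (b, z) \in Q -> prefB I' b y z = prefB I b y z.
Proof.
move=> [_ /(_ b)/setP/(_ (y, z))]; rewrite !inE /= => + yQ zQ.
by rewrite yQ zQ.
Qed.

Lemma sufficientS Q Q' I : Q \subset Q' -> sufficient I Q -> sufficient I Q'.
Proof. by move=> sQ [M hM]; exists M => I' /(consistentS sQ) /hM. Qed.

Lemma opt_le I Q : sufficient I Q -> opt I <= #|Q|.
Proof.
move=> hQ; rewrite /opt; case: arg_minnP => [|Q' _]; last first.
  by apply; apply/asboolP.
by apply/asboolP; apply: sufficientS hQ; apply/fintype.subsetP => q _; rewrite inE.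
Qed.

(** Before the first query in [E] both runs see the same answers, hence ask the same queries; so
    that first query is common to both. *)
Lemma run_common I I' (E : pred (B * A)) s Q :
    (forall Q, (forall q, q \in Q -> ~~ E q) -> consistent Q I I') ->
    (forall q, q \in Q -> ~~ E q) ->
  (exists q, [/\ E q, q \in (run I Q s).1 & q \in (run I' Q s).1])
  \/ run I Q s = run I' Q s.
Proof.
move=> hE; elim: s Q => [M|b a k IH] Q hQ; first by right.
have [Eba|nEba] := boolP (E (b, a)).
  by left; exists (b, a); split=> //=; rewrite inE eqxx.
have hQ' q : q \in ((b, a) |: Q)%SET -> ~~ E q.
  by rewrite !inE => /orP[/eqP ->|/hQ].
have eq_ans : intq I Q b a = intq I' Q b a.
  have [_ /(_ b)] := hE _ hQ'; rewrite /intq.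
  suff -> : queried ((b, a) |: Q)%SET b = (a |: queried Q b)%SET by [].
  by apply/setP => c; rewrite !inE xpair_eqE eqxx.
rewrite /= -eq_ans; case: (IH (intq I Q b a) _ hQ') => [[q [Eq q1 q2]]|->].
  by left; exists q; rewrite /= !inE q1 q2 !orbT.
by right.
Qed.

End Runs.

(** * The hard instances and their linear certificates *)

Section Instances.
Variables (A B : finType) (M : matching A B) (m : nat).
(* [h] picks the agents [star], [x i] and [t j] of [A]; those outside its image
   behave like the [t j]. *)
Variables (h : option ('I_m + 'I_m) -> A) (h_inj : injective h).

Local Notation star := (h None).
Local Notation x i := (h (Some (inl i))).
Local Notation t j := (h (Some (inr j))).

Definition isX (a : A) : bool := [exists i, a == x i].

Lemma isX_x i : isX (x i). Proof. by apply/existsP; exists i. Qed.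

Lemma isX_t j : ~~ isX (t j).
Proof. by apply/existsPn => i; apply/eqP => /h_inj. Qed.

Definition levA (a : A) (b : B) : nat :=
  let c := ofB M b in
  if a == star then nat_of_bool (c == star)
  else if c == a then 0
  else if (if isX a then ~~ isX c && (c != star) else c == star) then 1 else 2.

(* [S c a]: the agent [ofA M c] prefers [a] to its partner [c] in [M]. *)
Definition levB (S : rel A) (b : B) (a : A) : nat :=
  let c := ofB M b in if S c a then 0 else if a == c then 1 else 2.

Definition inst (S : rel A) : instance A B :=
  Instance (fun a => rank_order (levA a)) (fun b => rank_order (levB S b)).

(** The level of [a] for [b] depends on the relation only at the pair of [ofB M b] and [a]. *)
Lemma inst_consistent S S' (Q : {set B * A}) :
  (forall b a, (b, a) \in Q -> S (ofB M b) a = S' (ofB M b) a) ->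
  consistent Q (inst S) (inst S').
Proof.
move=> hS; split=> // b; apply/setP => -[y z]; rewrite !inE /=.
case yQ: (_ \in Q) => //; case zQ: (_ \in Q) => //.
by rewrite /rank /levB !hS.
Qed.

(** Only the second disjunct depends on [f]: these are the hidden edges. *)
Definition edges (f : 'I_m -> 'I_m) : rel A := fun c a =>
  [&& c == star, ~~ isX a & a != star]
  || [exists i, (a == x i) && (c == t (f i))].

Lemma edges_x f c i : edges f c (x i) = (c == t (f i)).
Proof.
rewrite /edges isX_x andbF /=; apply/existsP/idP => [[j /andP[/eqP/h_inj[<-]]]//|e].
by exists i; rewrite eqxx.
Qed.

Lemma edges_star f c : edges f c star = false.
Proof.
rewrite /edges eqxx !andbF /=; apply/existsP => -[j /andP[/eqP/h_inj]].
by [].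
Qed.

(** The first two families show that nobody prefers [star] to its own partner, the third pins the
    agents outside X, and the fourth reveals the hidden edges, which pin the [x i]. *)
Definition cert (f : 'I_m -> 'I_m) : {set B * A} :=
  (((fun a => (ofA M a, a)) @: [set: A]%SET :|:
    (fun a => (ofA M a, star)) @: [set: A]%SET) :|:
   ((fun a => (ofA M star, a)) @: [set: A]%SET :|:
    (fun i => (ofA M (t (f i)), x i)) @: [set: 'I_m]%SET))%SET.

Lemma card_cert f : m <= #|A| -> #|cert f| <= 4 * #|A|.
Proof.
move=> hm; rewrite /cert.
have c1 (g : A -> B * A) : #|g @: [set: A]%SET| <= #|A|.
  by rewrite (leq_trans (leq_imset_card _ _)) // cardsT.
have c2 (g : 'I_m -> B * A) : #|g @: [set: 'I_m]%SET| <= #|A|.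
  by rewrite (leq_trans (leq_imset_card _ _)) // cardsT card_ord.
have -> : 4 * #|A| = #|A| + #|A| + (#|A| + #|A|).
  by rewrite addnn -mul2n addnn -mul2n mulnA.
apply: leq_trans (leq_card_setU _ _) _; apply: leq_add;
  apply: leq_trans (leq_card_setU _ _) _; apply: leq_add; exact: c1 || exact: c2.
Qed.

Lemma mem_cert f a : [/\ (ofA M a, a) \in cert f, (ofA M a, star) \in cert f,
  (ofA M star, a) \in cert f & forall i, (ofA M (t (f i)), x i) \in cert f].
Proof.
by split=> [|||i]; rewrite !inE (imset_f, imset_f) ?inE ?orbT //;
  do !(apply/orP; (left + right)); apply: imset_f; rewrite inE.
Qed.

Lemma top_choice I Q S a b : consistent Q (inst S) I -> a != star ->
  ofA M a != b -> prefA I a (ofA M a) b.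
Proof.
move=> [<- _] na nb; apply: rank_lt; rewrite /levA (negbTE na) ofAK eqxx.
suff /negbTE -> : ofB M b != a by case: ifP.
by apply: contra nb => /eqP <-; rewrite ofBK.
Qed.

(** Only [star] lacks its top choice in [M], and nobody would leave its partner for [star]. *)
Lemma stable_cert f I : consistent (cert f) (inst (edges f)) I -> stable I M.
Proof.
move=> hI a b; apply/negP => /and3P[nb ab ba].
have [ea|na] := eqVneq a star; last first.
  by move/before_asym: ab; rewrite (top_choice hI) // eq_sym.
have [own ofstar _ _] := mem_cert f (ofB M b); rewrite ofBK in own ofstar.
move: ba; rewrite ea (consistent_prefB hI ofstar own).
apply/negP/before_asym; rewrite /= ; apply: rank_lt; rewrite /levB edges_star eqxx.
suff /negbTE -> : star != ofB M b by case: ifP.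
by apply: contra nb => /eqP e; rewrite ea e ofBK.
Qed.

(* First [star] keeps its partner, since anyone else would be blocked by the top
   choice; then the agents outside [X] do, since they would block with the
   partner of [star]; then [x i] does, since it would block with the partner of
   [t (f i)]. *)
Lemma stable_partner f I M' : consistent (cert f) (inst (edges f)) I ->
  stable I M' -> ofA M' =1 ofA M.
Proof.
move=> hI st; have hA := hI.1.
have top a : a != star -> ofA M' a != ofA M a -> prefA I a (ofA M a) (ofA M' a).
  by move=> na ne; rewrite (top_choice hI) // eq_sym.
have partner_star : ofA M' star = ofA M star.
  apply/eqP/negPn/negP => ne; set c := ofB M (ofA M' star).
  have cK : ofA M c = ofA M' star by rewrite ofBK.
  have nc : c != star by apply: contra ne => /eqP e; rewrite -cK e.
  have ne' : ofA M' c != ofA M c.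
    by rewrite cK; apply: contra nc => /eqP /(can_inj (ofAK M')) ->.
  have := st c (ofA M c); rewrite /blocking eq_sym ne' top //= cK ofAK -cK.
  have [own ofstar _ _] := mem_cert f c.
  rewrite (consistent_prefB hI own ofstar) /= rank_lt //.
  by rewrite /levB ofAK edges_star eqxx eq_sym (negbTE nc); case: ifP.
have ofB_star : ofB M' (ofA M star) = star by rewrite -partner_star ofAK.
have partner_nonX a : ~~ isX a -> ofA M' a = ofA M a.
  move=> nX; have [->//|na] := eqVneq a star.
  apply/eqP/negPn/negP => ne.
  have nb : ofA M star != ofA M' a.
    by rewrite -partner_star (can_eq (ofAK M')) eq_sym.
  have := st a (ofA M star); rewrite /blocking nb ofB_star /= -hA.
  have [_ _ ofa _] := mem_cert f a; have [own _ _ _] := mem_cert f star.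
  rewrite (consistent_prefB hI ofa own) /= !rank_lt //.
    by rewrite /levB ofAK edges_star eqxx /edges eqxx nX na.
  rewrite /levA (negbTE na) ofAK eqxx (negbTE nX) eq_sym (negbTE na).
  have /negbTE -> : ofB M (ofA M' a) != a.
    by apply: contra ne => /eqP e; rewrite -{2}e ofBK.
  suff /negbTE -> : ofB M (ofA M' a) != star by [].
  by apply: contra nb => /eqP e; rewrite -e ofBK.
move=> a; have [/existsP[i /eqP ->]|/partner_nonX//] := boolP (isX a).
apply/eqP/negPn/negP => ne; set c := ofB M (ofA M' (x i)).
have cK : ofA M c = ofA M' (x i) by rewrite ofBK.
(* Agents outside X keep their partners, so [x i] can only have received the partner of another [x],
   which it ranks below that of [t (f i)]. *)
have Xc : isX c.
  have [//|nX] := boolP (isX c).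
  by have := partner_nonX _ nX; rewrite cK => /(can_inj (ofAK M')) e;
    rewrite e isX_x in nX.
have te : ofA M' (t (f i)) = ofA M (t (f i)) by apply/partner_nonX/isX_t.
have nb : ofA M (t (f i)) != ofA M' (x i).
  by rewrite -te (can_eq (ofAK M')); apply/eqP => /h_inj.
have tN : (t (f i) == star) = false by apply/eqP => /h_inj.
have xN : (x i == star) = false by apply/eqP => /h_inj.
have tx : (t (f i) == x i) = false by apply/eqP => /h_inj.
have := st (x i) (ofA M (t (f i))); rewrite /blocking nb -{3}te ofAK /= -hA.
have [own _ _ _] := mem_cert f (t (f i)).
have [_ _ _ /(_ i) ofx] := mem_cert f star.
rewrite (consistent_prefB hI ofx own) /= !rank_lt //.
  rewrite /levB ofAK edges_x eqxx /edges tN /=; case: existsP => //.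
  by move=> [j /andP[/eqP /h_inj]].
rewrite /levA xN ofAK tN tx isX_x (negbTE (isX_t _)) //= -/c Xc /=.
by case: eqP => [e|//]; rewrite -cK e eqxx in ne.
Qed.

Lemma partner_ofB M' : ofA M' =1 ofA M -> ofB M' =1 ofB M.
Proof. by move=> e b; rewrite -{1}(ofBK M b) -e ofAK. Qed.

Lemma cert_sufficient f : sufficient (inst (edges f)) (cert f).
Proof.
exists M => I hI; split; first exact: stable_cert hI.
by move=> M' /(stable_partner hI) /partner_ofB e b; left; rewrite e.
Qed.

(** * Exchanging the partners of two unresolved agents *)

Definition swap_edges (f : 'I_m -> 'I_m) (a a' : A) : rel A := fun c z =>
  if (z == a) || (z == a') then c == tperm a a' z else edges f c z.

Lemma swap_matchingP a a' :
  cancel (ofA M \o tperm a a') (tperm a a' \o ofB M) /\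
  cancel (tperm a a' \o ofB M) (ofA M \o tperm a a').
Proof. by split=> y /=; rewrite ?ofAK ?tpermK ?ofBK. Qed.

Definition swap_matching a a' : matching A B :=
  Matching (swap_matchingP a a').1 (swap_matchingP a a').2.

Lemma swap_stable f i i' :
  stable (inst (swap_edges f (x i) (x i'))) (swap_matching (x i) (x i')).
Proof.
set s := swap_edges _ _ _; set I := inst s; set p := tperm (x i) (x i').
move=> a b; apply/negP => /and3P[/= nb ab /rank_lt_lev].
rewrite -/p; set c := ofB M b => lev_le.
have cK : ofA M c = b by rewrite ofBK.
have nac : a != p c.
  by apply: contra nb => /eqP ->; rewrite tpermK cK.
(* The partner of [b] has level 0 if it was exchanged, and otherwise no other agent shares its level
   1; so a blocking [a] must have level 0. *)
have sca : s c a.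
  move: lev_le; rewrite /levB -/c; case: (s c a) => //.
  have [swc|nswc] := boolP ((c == x i) || (c == x i')).
    suff -> : s c (p c) by case: eqP.
    rewrite /s /swap_edges -/p; case/orP: swc => /eqP -> ;
      by rewrite ?tpermL ?tpermR !eqxx ?orbT ?tpermL ?tpermR ?eqxx.
  move: nswc; rewrite negb_or => /andP[n1 n2].
  have pc : p c = c by rewrite /p tpermD // eq_sym.
  by rewrite pc eqxx -[in a == c]pc (negbTE nac); case: ifP.
move: sca; rewrite /s /swap_edges.
have [_ /eqP e|] := boolP ((a == x i) || (a == x i')).
  by rewrite e tpermK eqxx in nac.
rewrite negb_or => /andP[n1 n2].
have pa : tperm (x i) (x i') a = a by rewrite tpermD // eq_sym.
have [->|na] := eqVneq a star; first by rewrite edges_star.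
have := top_choice (consistent_refl finset.set0 I) na.
rewrite pa in ab nb; rewrite eq_sym in nb.
by move/(_ _ nb)/before_asym; rewrite /= ab.
Qed.

(* Otherwise the answers are consistent with an instance in which exchanging the
   partners of [x i] and [x i'] gives a stable matching that [B] prefers. *)
Lemma proves_unresolved f i i' (Q : {set B * A}) M0 : i != i' ->
  proves (inst (edges f)) Q M0 ->
  (ofA M (t (f i)), x i) \notin Q -> (ofA M (t (f i')), x i') \notin Q ->
  ((ofA M (x i'), x i) \in Q) || ((ofA M (x i), x i') \in Q).
Proof.
move=> ni prf u u'; apply/negPn/negP; rewrite negb_or => /andP[v v'].
have [st0 _] := prf _ (consistent_refl _ _).
have M0E := partner_ofB (stable_partner (consistent_refl _ _) st0).
have nx : (x i == x i') = false by apply/negbTE; apply: contra ni => /eqP /h_inj [->].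
have hS : consistent Q (inst (edges f)) (inst (swap_edges f (x i) (x i'))).
  apply: inst_consistent => b a baQ; rewrite /swap_edges.
  (* Neither the hidden edge to [x j] nor its replacement was queried, so both tests are false on
     [Q]. *)
  have aux j c d : ofA M d = b -> (ofA M (t (f j)), x j) \notin Q ->
      (ofA M c, x j) \notin Q -> (b, x j) \in Q -> (d == t (f j)) = (d == c).
    move=> eb w1 w2 w3; have /negbTE -> : d != t (f j).
      by apply: contra w1 => /eqP <-; rewrite eb.
    by apply/esym/negbTE; apply: contra w2 => /eqP <-; rewrite eb.
  case: eqP => [e|_] /=; last case: eqP => [e|//].
    rewrite e tpermL edges_x; apply: (aux i); rewrite ?ofBK //; by rewrite -e.
  rewrite e tpermR edges_x; apply: (aux i'); rewrite ?ofBK //; by rewrite -e.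
have [_ /(_ _ (@swap_stable f i i') (ofA M (x i)))] := prf _ hS.
rewrite M0E /= ofAK tpermL => -[/eqP|/rank_lt_lev]; first by rewrite nx.
rewrite /levB ofAK /swap_edges !eqxx nx orbT tpermL tpermR eqxx.
by rewrite nx.
Qed.

End Instances.

(** * Counting queries over all [f] *)

Section Counting.
Variable m : nat.
Local Notation F := {ffun 'I_m -> 'I_m}.

Definition update (f : F) (i j : 'I_m) : F := [ffun k => if k == i then j else f k].

(** The map from [(f, j)] to [(update f i j, f i)] is an involution. *)
Lemma sum_update (i : 'I_m) (g : F -> nat) :
  \sum_f \sum_j g (update f i j) = m * \sum_f g f.
Proof.
rewrite pair_bigA /= (reindex_onto (fun p : F * 'I_m => (update p.1 i p.2, p.1 i))
   (fun p : F * 'I_m => (update p.1 i p.2, p.1 i))) /=; last first.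
  move=> [f j] _ /=; rewrite /update ffunE eqxx; congr pair.
  by apply/ffunP => k; rewrite !ffunE; case: eqP => // ->.
rewrite (eq_bigl predT) => [|[f j]]; last first.
  apply/eqP => /=; rewrite /update ffunE eqxx; congr pair.
  by apply/ffunP => k; rewrite !ffunE; case: eqP => // ->.
rewrite (eq_bigr (fun p : F * 'I_m => g p.1)) => [|[f j] _ /=]; last first.
  congr g; apply/ffunP => k; rewrite !ffunE; by case: eqP => // ->.
rewrite -(pair_bigA _ (fun f _ => g f)) /= big_distrr /=.
by apply: eq_bigr => f _; rewrite sum_nat_const card_ord.
Qed.

(** On the [k] elements of [a], [r] contains a tournament, hence at least [k * (k - 1) / 2]
    pairs. *)
Lemma tournament_sum (r : rel 'I_m) (a : pred 'I_m) :
  (forall i i', i != i' -> a i -> a i' -> r i i' || r i' i) ->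
  (\sum_i a i) ^ 2 <= 2 * (\sum_i \sum_i' r i i') + \sum_i a i.
Proof.
move=> hr; rewrite -mulnn big_distrl /= mul2n -addnn {2}exchange_big /=.
rewrite -!big_split /=; apply: leq_sum => i _.
rewrite big_distrr /= -big_split /= addnC.
rewrite [leqLHS](bigD1 i) //= [X in _ <= _ + X](bigD1 i) //=.
rewrite addnA; apply: leq_add; first by case: (a i).
apply: leq_sum => i' ni; have := @hr i i'; rewrite eq_sym ni.
by case: (a i); case: (a i') => //= /(_ isT isT isT); case: (r i i'); case: (r i' i).
Qed.

(** Here [r] also holds on the diagonal of [a], which absorbs the linear term. *)
Lemma tournament_sum_refl (r : rel 'I_m) (a : pred 'I_m) :
  (forall i i', a i -> a i' -> r i i' || r i' i) ->
  (\sum_i a i) ^ 2 <= 2 * (\sum_i \sum_i' (a i && r i i')).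
Proof.
move=> hr; rewrite -mulnn big_distrl /= mul2n -addnn {2}exchange_big /=.
rewrite -!big_split /=; apply: leq_sum => i _.
rewrite big_distrr /= -big_split /=.
apply: leq_sum => i' _; have := @hr i i'.
by case: (a i); case: (a i') => //= /(_ isT isT); case: (r i i'); case: (r i' i).
Qed.

(* [q f i j]: on the instance of [f], it is asked whether the partner of [t j]
   prefers [x i] to [t j]; [p f i i']: whether that of [x i'] prefers [x i]. *)
Variables q p : F -> rel 'I_m.
Hypothesis q_common : forall f i j j',
  q (update f i j) i j -> q (update f i j') i j' ->
  q (update f i j) i j' || q (update f i j') i j.
Hypothesis p_unresolved : forall f i i', i != i' ->
  ~~ q f i (f i) -> ~~ q f i' (f i') -> p f i i' || p f i' i.

(* When only [f i] varies, the [k] values [j] at which [q f i j] holds are pairwise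
   compared by [q_common], which costs [k ^ 2 / 2] in total. *)
Lemma sum_resolving i :
  4 * m * (\sum_f q f i (f i)) <= 8 * (\sum_f \sum_j q f i j) + m * #|{: F}|.
Proof.
have m_gt0 : 0 < m by apply: leq_ltn_trans (ltn_ord i).
rewrite -(leq_pmul2l m_gt0) mulnDr mulnCA [m * (8 * _)]mulnCA.
rewrite -!(sum_update i) !mulnA [_ * #|_|]mulnC -sum_nat_const.
rewrite !big_distrr /= -big_split /=.
apply: leq_sum => f _.
have := @tournament_sum_refl (fun j => q (update f i j) i)
   (fun j => q (update f i j) i j) (fun j j' => @q_common f i j j').
set K := \sum_i0 _ => hK.
have le : \sum_j \sum_j' (q (update f i j) i j && q (update f i j) i j') <=
   \sum_j \sum_j' q (update f i j) i j'.
  by apply: leq_sum => j _; apply: leq_sum => j' _; case: (q _ _ j).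
have -> : \sum_j q (update f i j) i (update f i j i) = K.
  by apply: eq_bigr => j _; rewrite {2}/update ffunE eqxx.
(* From [K ^ 2 <= 2 * s], the inequality of arithmetic and geometric means gives [4 * m * K <= m ^ 2
   + 4 * K ^ 2 <= m ^ 2 + 8 * s]. *)
have [+ _] := nat_AGM2 m (2 * K); move: (leq_trans hK (leq_mul (leqnn 2) le)).
rewrite -!mulnn; clearbody K; set s := \sum_j \sum_j' _; clearbody s; clear.
nia.
Qed.

(** Each [i] with [q f i (f i)] is expensive by [sum_resolving], while the others form a tournament
    under [p f]; the bound balances the two costs. *)
Lemma sum_queries :
  2 * m ^ 2 * #|{: F}| <=
  8 * (\sum_f (\sum_i \sum_j q f i j + \sum_i \sum_i' p f i i'))
   + 4 * m * #|{: F}|.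
Proof.
have H1 : 4 * m * (\sum_f \sum_i q f i (f i)) <=
    8 * (\sum_f \sum_i \sum_j q f i j) + m * m * #|{: F}|.
  rewrite exchange_big [in leqRHS]exchange_big /=.
  have -> : m * m * #|{: F}| = \sum_(i < m) m * #|{: F}|.
    by rewrite sum_nat_const card_ord mulnA.
  rewrite [4 * m * _]big_distrr [8 * _]big_distrr -big_split /=.
  by apply: leq_sum => i _; exact: sum_resolving.
rewrite big_split /= mulnDr.
have H2 : 3 * m ^ 2 * #|{: F}| <= 4 * m * (\sum_f \sum_i q f i (f i))
   + 8 * (\sum_f \sum_i \sum_i' p f i i') + 4 * m * #|{: F}|.
  rewrite ![_ * #|_|]mulnC -!sum_nat_const.
  rewrite [4 * m * _]big_distrr [8 * _]big_distrr -!big_split /=.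
  apply: leq_sum => f _.
  have := @tournament_sum (p f) (fun i => ~~ q f i (f i)) (@p_unresolved f).
  have : \sum_i q f i (f i) + \sum_i ~~ q f i (f i) = m.
    rewrite -big_split /= (eq_bigr (fun=> 1)) ?sum1_card ?card_ord // => i _.
    by case: (q f i (f i)).
  move: (\sum_i q _ _ _) (\sum_i ~~ _) (\sum_i \sum_i' _) => r u s <-.
  (* With [m = r + u], [4 * m * r + 4 * u ^ 2 = 4 * m ^ 2 - 4 * r * u], and [4 * r * u <= m ^ 2]. *)
  by have [+ _] := nat_AGM2 r u; rewrite -!mulnn; nia.
move: H1 H2; set a := \sum_f _; set b := \sum_f _; set c := \sum_f _.
by move: #|{: F}| => N; nia.
Qed.

End Counting.

(** * The query sum of a correct deterministic algorithm *)

Lemma sum_mem_le_size (K : finType) (X : eqType) (g : K -> X) (s : seq X) :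
  injective g -> \sum_k (g k \in s) <= size s.
Proof.
move=> g_inj; rewrite -big_mkcond sum1_card cardE -(size_map g).
apply: uniq_leq_size; first by rewrite map_inj_uniq // enum_uniq.
by move=> _ /mapP[k + ->]; rewrite mem_enum.
Qed.

Section LowerBound.
Variables (A B : finType) (M : matching A B) (m : nat).
Variables (h : option ('I_m + 'I_m) -> A) (h_inj : injective h).
Local Notation x i := (h (Some (inl i))).
Local Notation t j := (h (Some (inr j))).

Lemma edges_update f i j j' c a :
  (c, a) != (t j, x i) -> (c, a) != (t j', x i) ->
  edges h (update f i j) c a = edges h (update f i j') c a.
Proof.
have [/existsP[k /eqP ->]|nX _ _] := boolP (isX h a).
  move=> n1 n2; rewrite !edges_x // /update !ffunE.
  have [eki|//] := eqVneq k i; rewrite eki in n1 n2.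
  have /negbTE -> : c != t j by apply: contra n1 => /eqP ->.
  by apply/esym/negbTE; apply: contra n2 => /eqP ->.
congr orb; apply/existsP/existsP => -[k /andP[/eqP e _]];
  by rewrite e isX_x in nX.
Qed.

Variable alg : algorithm A B.
Hypothesis alg_solves : solves alg.

Lemma sum_num_queries :
  2 * m ^ 2 * #|{: {ffun 'I_m -> 'I_m}}| <=
  8 * (\sum_(f : {ffun 'I_m -> 'I_m}) num_queries alg (inst M h (edges h f)))
   + 4 * m * #|{: {ffun 'I_m -> 'I_m}}|.
Proof.
pose Q (f : {ffun 'I_m -> 'I_m}) := (execute alg (inst M h (edges h f))).1.
have M_inj := can_inj (ofAK M).
pose q f : rel 'I_m := fun i j => (ofA M (t j), x i) \in Q f.
pose p f : rel 'I_m := fun i i' => (ofA M (x i'), x i) \in Q f.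
have := @sum_queries m q p.
have q_common f i j j' :
  q (update f i j) i j -> q (update f i j') i j' ->
  q (update f i j) i j' || q (update f i j') i j.
  (* The two instances differ only at these queries. If the runs share one of them, one run has
     asked for the edge of the other instance; otherwise the runs coincide. *)
  move=> q1 q2; pose E := pred2 (ofA M (t j), x i) (ofA M (t j'), x i).
  have [||[e [/orP[]/eqP -> e1 e2]]|eQ] := @run_common _ _
      (inst M h (edges h (update f i j))) (inst M h (edges h (update f i j')))
      E (alg (fun a => rank_order (levA M h a))) finset.set0.
  - move=> Q0 hQ0; apply: inst_consistent => b a /hQ0.
    rewrite /E /= negb_or => /andP[n1 n2]; apply: edges_update.
      by apply: contra n1 => /eqP[<- ->]; rewrite ofBK.
    by apply: contra n2 => /eqP[<- ->]; rewrite ofBK.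
  - by move=> e; rewrite inE.
  - by rewrite /q /Q /execute /= e2 orbT.
  - by rewrite /q /Q /execute /= e1.
  - by move: q1; rewrite /q /Q /execute /= eQ => ->; rewrite orbT.
move/(_ q_common) => {q_common}.
have p_unresolved f i i' : i != i' -> ~~ q f i (f i) -> ~~ q f i' (f i') ->
    p f i i' || p f i' i.
  move=> ni u u'.
  by have := proves_unresolved h_inj ni (alg_solves (I := inst M h (edges h f)));
    rewrite !inE; apply.
move/(_ p_unresolved) => {p_unresolved} /leq_trans; apply.
rewrite leq_add2r leq_mul2l /=; apply: leq_sum => f _.
(* The queries counted by [q] and [p] are pairwise distinct, so nothing is counted twice. *)
pose g (k : 'I_m * 'I_m + 'I_m * 'I_m) := match k with
  | inl ij => (ofA M (t ij.2), x ij.1) | inr ij => (ofA M (x ij.2), x ij.1) end.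
have g_inj : injective g.
  by move=> [[i j]|[i j]] [[i' j']|[i' j']] [/M_inj/h_inj + /h_inj] //= => -[->] [->].
apply: leq_trans (sum_mem_le_size (Q f) g_inj).
by rewrite big_sumType /= !pair_bigA.
Qed.

End LowerBound.

(** * From the average over [f] to the competitive ratio *)

Lemma matching_of_card (A B : finType) : #|A| = #|B| -> inhabited (matching A B).
Proof.
move=> e; constructor.
apply: (@Matching _ _ (fun a => enum_val (cast_ord e (enum_rank a)))
   (fun b => enum_val (cast_ord (esym e) (enum_rank b)))) => y.
  by rewrite enum_valK cast_ordK enum_rankK.
by rewrite enum_valK cast_ordKV enum_rankK.
Qed.

Lemma injection_of_card (X Y : finType) : #|X| <= #|Y| ->
  exists g : X -> Y, injective g.
Proof.
move=> le; exists (fun x => enum_val (widen_ord le (enum_rank x))) => x y.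
by move=> /enum_val_inj /(congr1 val) /= /val_inj /enum_rank_inj.
Qed.

Local Open Scope ring_scope.

Lemma exists_ge_average (R : realType) (F : finType) (g : F -> \bar R) (c : R) :
  (forall f, 0 <= g f)%E -> (0 < #|F|)%N ->
  ((#|F|%:R * c)%:E <= \sum_f g f)%E -> exists f, (c%:E <= g f)%E.
Proof.
move=> g0 F0 le; apply: contrapT => /forallNP hN.
have lt f : (g f < c%:E)%E by rewrite ltNge; apply/negP.
have gfin f : g f \is a fin_num by rewrite ge0_fin_numE // (lt_trans (lt f)) ?ltry.
move: le; apply/negP; rewrite -ltNge.
under eq_bigr => f _ do rewrite -(fineK (gfin f)).
rewrite sumEFin lte_fin.
have -> : #|F|%:R * c = \sum_(f : F) c by rewrite sumr_const mulr_natl.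
have [f0 _] := card_gt0P F0.
apply: ltr_sum => [|f _]; first by apply/hasP; exists f0; rewrite ?mem_index_enum.
by rewrite -lte_fin fineK.
Qed.

(** The constant is [512 = 128 * 4]. The case [opt I = 0] is harmless, since the inverse of 0 in
    [\bar R] is [+oo]. *)
Lemma competitive_ratio_ge (R : realType) (A B : finType)
    (cost : instance A B -> \bar R) I (n : nat) :
  (0 < n)%N -> (opt I <= 4 * n)%N -> (((n ^ 2)%N%:R / 128%:R)%:E <= cost I)%E ->
  ((512%:R^-1 * n%:R)%:E <= competitive_ratio cost)%E.
Proof.
move=> n_gt0 le_opt le_cost.
apply: le_trans (ereal_sup_ubound _) => /=; last by exists I.
have n4 : (4 * n)%N%:R != 0 :> R by rewrite pnatr_eq0 muln_eq0 -lt0n n_gt0.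
apply: (@le_trans _ _ (((n ^ 2)%N%:R / 128%:R)%:E / (4 * n)%N%:R%:E)%E).
  rewrite inver (negbTE n4) -EFinM lee_fin ler_pdivlMr ?ltr0n ?muln_gt0 ?n_gt0 //.
  rewrite ler_pdivlMr ?ltr0n // -!mulrA ler_pdivrMl ?ltr0n // -!natrM ler_nat.
  by rewrite -mulnn; lia.
apply: le_trans (lee_wpmul2r _ le_cost); last by rewrite inve_ge0 lee_fin.
apply: lee_wpmul2l; first by rewrite lee_fin divr_ge0.
by rewrite lee_pV2 ?inE ?lee_fin ?ler_nat ?ler0n.
Qed.

(** This is the averaging step of Yao's principle: a bound on the sum over [f] for almost every seed
    passes to the expectations by linearity. *)
Lemma expected_sum_ge d (T : measurableType d) (R : realType)
    (P : probability T R) (F : finType) (g : F -> T -> nat) (c : R) :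
  (forall f, measurable_fun (classical_sets.setT : set T)
               (fun w => (g f w)%:R%R : R)) ->
  0 <= c -> {ae P, forall w, c <= (\sum_f g f w)%N%:R} ->
  (c%:E <= \sum_f expectation P (fun w => (g f w)%:R))%E.
Proof.
move=> mg c0 le.
have mE f : measurable_fun (classical_sets.setT : set T)
    (EFin \o (fun w => (g f w)%:R : R)).
  exact/measurable_EFinP.
have -> : (\sum_f expectation P (fun w => (g f w)%:R) =
    \int[P]_w \sum_f ((g f w)%:R : R)%:E)%E.
  rewrite (ge0_integral_sum P measurableT mE) //.
    by apply: eq_bigr => f _; rewrite unlock.
  by move=> f w _; rewrite lee_fin.
have -> : c%:E = (\int[P]_w cst c%:E w)%E.
  have PT := integral_cst P measurableT c%:E.
  by rewrite -[LHS]mule1 -(probability_setT P); exact: esym PT.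
apply: ae_ge0_le_integral => //.
- by move=> w _; rewrite sume_ge0 // => f _; rewrite lee_fin.
- exact: emeasurable_sum.
- case: le => N [mN N0 sN]; exists N; split => // w /= nle; apply: sN => /= h.
  by apply: nle => _; rewrite sumEFin lee_fin -natr_sum.
Qed.

Theorem theorem17 (R : realType) :
  exists (c : R) (n0 : nat), 0 < c /\
    forall (n : nat) (A B : finType),
      (n0 <= n)%N -> #|A| = n -> #|B| = n ->
      (forall alg : algorithm A B, solves alg ->
         ((c * n%:R)%:E <= det_ratio R alg)%E) /\
      (forall (d : measure_display) (T : measurableType d)
         (P : probability T R) (alg : T -> algorithm A B),
         randomized_solves P alg ->
         ((c * n%:R)%:E <= rand_ratio P alg)%E).
Proof.
(* From [n >= 12] follow [m >= 4] and [n <= 4 * m] for [m = n %/ 3]. *)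
exists 512%:R^-1, 12%N; split; first by rewrite invr_gt0 ltr0n.
move=> n A B n_ge cA cB.
have [M] : inhabited (matching A B) by apply: matching_of_card; rewrite cA cB.
pose m := (n %/ 3)%N.
have m_le : (#|{: option ('I_m + 'I_m)}| <= #|A|)%N.
  by rewrite card_option card_sum card_ord cA /m; lia.
have [h h_inj] := injection_of_card m_le.
pose F := {ffun 'I_m -> 'I_m}; pose I (f : F) := inst M h (edges h f).
have F0 : (0 < #|{: F}|)%N.
  by rewrite card_ffun card_ord expn_gt0; apply/orP; left; rewrite /m; lia.
have opt_I f : (opt (I f) <= 4 * n)%N.
  rewrite -cA (leq_trans (opt_le (cert_sufficient M h_inj f))) // card_cert //.
  by rewrite cA /m; lia.
have sum_queries (alg : algorithm A B) : solves alg ->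
    #|{: F}|%:R * ((n ^ 2)%N%:R / 128%:R) <= (\sum_f num_queries alg (I f))%N%:R :> R.
  move=> /(@sum_num_queries _ _ M _ _ h_inj); rewrite -/F -/(I _) => le.
  rewrite mulrA ler_pdivrMr ?ltr0n // -!natrM ler_nat.
  move: le; set S := (\sum_f _)%N; set N := #|_|.
  have n_le : (n * n * N <= 4 * m * (4 * m) * N)%N.
    by rewrite leq_mul // leq_mul // /m; lia.
  (* The linear term takes at most half of [2 * m ^ 2 * N], leaving [m ^ 2 * N <= 8 * S]; then
     [n <= 4 * m] yields [128 = 16 * 8]. *)
  have : (4 * (m * N) <= m * (m * N))%N by rewrite leq_mul // /m; lia.
  by move: le n_le; rewrite -!mulnn; move: (m) (N) (S); lia.
have n_gt0 : (0 < n)%N by lia.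
split=> [alg|d T P alg [meas]] alg_solves.
  have [|//||f le] := @exists_ge_average R F (fun f => (num_queries alg (I f))%:R%:E)
      ((n ^ 2)%N%:R / 128%:R).
  - by move=> f; rewrite lee_fin.
  - by rewrite sumEFin -natr_sum lee_fin sum_queries.
  exact: competitive_ratio_ge n_gt0 (opt_I f) le.
have [|//||f le] := @exists_ge_average R F
    (fun f => expectation P (fun w => (num_queries (alg w) (I f))%:R))
    ((n ^ 2)%N%:R / 128%:R).
- by move=> f; apply: expectation_ge0 => w.
- apply: expected_sum_ge => [f||]; first exact: meas.
    by rewrite mulr_ge0 // divr_ge0.
  case: alg_solves => N [mN N0 sN]; exists N; split => // w /= nle; apply: sN => /= s.
  by apply: nle; apply: sum_queries.
exact: competitive_ratio_ge n_gt0 (opt_I f) le.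
Qed.
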